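(* Let $I$ be a countable set and let $(p_{ij})_{i,j\in I}$ be a positive matrix semigroup over $I$. Then for all $i,j\in I$, either $p_{ij}(t)=0$ for all $t>0$, or $p_{ij}(t)>0$ for all $t>0$.
   Context: Let $I$ be a countable set. A family of functions $p_{ij}\colon(0,\infty)\to[0,\infty)$, $i,j\in I$, is called a positive matrix semigroup over the index set $I$ if for all $i,j\in I$: (a) $p_{ij}$ is continuous on $(0,\infty)$, and (b) $p_{ij}(t+s)=\sum_{k\in I}p_{ik}(t)p_{kj}(s)$ for all $t,s>0$. (No continuity at time $0$ and no condition on row sums is assumed.) *)

(* Defs.v *)
From mathcomp Require Import all_boot all_order all_algebra.
From mathcomp Require Import all_classical all_reals all_analysis.
Set Implicit Arguments.
Unset Strict Implicit.
Unset Printing Implicit Defensive.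
Import Order.TTheory GRing.Theory Num.Theory.
Import numFieldNormedType.Exports.
Local Open Scope classical_set_scope.
Local Open Scope ring_scope.

(* Only the values [p i j t] with [0 < t] are constrained: [p i j] is a total
   function standing for a function on (0, oo).  The sum over [I] is the
   unordered sum of nonnegative terms in the extended reals, so the semigroup
   identity also says that this sum is finite. *)
Record positive_matrix_semigroup (R : realType) (I : countType)
    (p : I -> I -> R -> R) : Prop := PositiveMatrixSemigroup {
  pms_ge0 : forall (i j : I) (t : R), 0 < t -> 0 <= p i j t ;
  pms_continuous :
    forall i j : I, {within `]0, +oo[%classic, continuous (p i j)} ;
  pms_semigroup : forall (i j : I) (t s : R), 0 < t -> 0 < s ->
    (p i j (t + s))%:E = (\esum_(k in [set: I]) (p i k t * p k j s)%:E)%E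
}.

(* Main.v *)
Require Import Defs.
From mathcomp Require Import all_boot all_order all_algebra.
From mathcomp Require Import all_classical all_reals all_analysis.
From mathcomp Require Import ring lra zify.
Import Order.TTheory GRing.Theory Num.Theory.
Import numFieldNormedType.Exports.
Local Open Scope ring_scope.
Set Implicit Arguments.
Unset Strict Implicit.
Unset Printing Implicit Defensive.

(** Write [A_ij] for the open set of times [t > 0] with [p_ij(t) > 0]; the
    semigroup identity gives [A_ik + A_kj <= A_ij].  The claim is that a
    nonempty [A_ij] is all of [(0, oo)].

    These inclusions alone are not enough (on the rationals, take
    [A_ij = {t | t > j - i}]), so one needs an estimate on the numbers.
    If [p_ij(T) > 0], then
    [P(X_s = k) = p_ik(s) p_kj(T - s) / p_ij(T)] describes a bridge from [i] to
    [j] of duration [T].  Its finite-dimensional laws are probabilities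
    because the semigroup identity is exact.  By continuity and compactness
    (Dini) a single finite set [F] of states carries most of the mass of [X_s],
    uniformly for [s] away from [0] and [T] ([uniform_capture]).  Cut [T] into
    [N] equal steps: the expected number of grid times that the bridge spends
    in [F] is close to [N], so some chain of [N] positive transitions from [i]
    to [j] is outside [F] only for a small fraction of its vertices
    ([expected_visits_le], [path_mostly_in_finite]).

    The set [F] does not depend on [N].  Hence for large [N] this chain must
    repeat a state [k], so that [A_ik], [A_kk] and [A_kj] are nonempty
    ([leads_through_recurrent]).  Erasing all loops leaves at most
    [#|F|] vertices in [F] and few outside, so the total duration
    becomes a small fraction of [T]: a nonempty [A_ij] contains arbitrarily
    small times ([positive_small_times]).

    Taking short times in [A_ik] and [A_kj] and many copies of a short time of
    [A_kk] shows that [A_ij] is dense ([positive_dense]).  Finally, pick [k]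
    with [A_ik] and [A_kj] nonempty.  For any [t] the open dense sets [A_ik] and
    [t - A_kj] of [(0, t)] meet, which gives [p_ij(t) > 0]
    ([leads_to_positive]). *)

(** * Unordered sums with a finite real value *)

(** Packages nonnegativity with the value of the extended real sum, so that
    the rest of the argument takes place among real numbers. *)
Definition has_sum (R : realType) (I : choiceType) (f : I -> R) (s : R) : Prop :=
  (forall k, 0 <= f k) /\
  s%:E = (\esum_(k in [set: I]%classic) (f k)%:E)%E.

Section HasSum.
Context {R : realType} {I : choiceType}.
Implicit Types (f g : I -> R) (r : seq I) (s t c d x : R).

Lemma has_sum_ge_seq f s r : has_sum f s -> uniq r -> \sum_(k <- r) f k <= s.
Proof.
move=> [f0 fs] ur; rewrite -lee_fin fs -sumEFin fsbig_seq//.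
by apply: ereal_sup_ubound; exists [set` r]%classic.
Qed.

Lemma has_sum_gt_seq f s x : has_sum f s -> x < s ->
  exists2 r, uniq r & x < \sum_(k <- r) f k.
Proof.
move=> [f0 fs]; rewrite -lte_fin fs => /ereal_sup_gt[_ [A [finA _] <-]].
rewrite fsbig_finite//= sumEFin lte_fin => xA.
by exists (finmap.enum_fset (fset_set A)) => //; exact: finmap.fset_uniq.
Qed.

(** The factor [d] may be negative: the hypothesis then forces both families to
    vanish.  The induction in [expected_visits_le] relies on this. *)
Lemma has_sum_le f g s t d : has_sum f s -> has_sum g t ->
  (forall k, f k <= d * g k) -> s <= d * t.
Proof.
move=> fs gt fg; case: (leP 0 d) => [d0|d0]; last first.
  have g0 k : g k = 0.
    apply/eqP; rewrite eq_le gt.1 andbT -(nmulr_rge0 _ d0).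
    exact: le_trans (fs.1 k) (fg k).
  have f0 k : f k = 0.
    by apply/eqP; rewrite eq_le fs.1 andbT (le_trans (fg k))// g0 mulr0.
  case: fs gt => _ + [_].
  rewrite !esum1 => [[->] [->]||]; first by rewrite mulr0.
  - by move=> k _; rewrite g0.
  - by move=> k _; rewrite f0.
rewrite leNgt; apply/negP => /(has_sum_gt_seq fs)[r ur]; apply/negP.
rewrite -leNgt (@le_trans _ _ (\sum_(k <- r) d * g k))//.
  exact: ler_sum.
by rewrite -mulr_sumr ler_wpM2l// has_sum_ge_seq.
Qed.

Lemma has_sumD f g s t : has_sum f s -> has_sum g t ->
  has_sum (fun k => f k + g k) (s + t).
Proof.
move=> [f0 fs] [g0 gt]; split=> [k|]; first exact: addr_ge0.
rewrite EFinD fs gt -esumD//.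
- by move=> k _; rewrite lee_fin.
- by move=> k _; rewrite lee_fin.
Qed.

Lemma has_sum0 : has_sum (fun _ : I => 0 : R) 0.
Proof. by split=> //; rewrite esum1. Qed.

Lemma has_sum_sum (J : Type) (q : seq J) (F : J -> I -> R) (S : J -> R) :
  (forall j, has_sum (F j) (S j)) ->
  has_sum (fun k => \sum_(j <- q) F j k) (\sum_(j <- q) S j).
Proof.
move=> FS; elim: q => [|j q IH].
  rewrite big_nil (_ : (fun _ => _) = fun=> 0); first exact: has_sum0.
  by apply/funext => k; rewrite big_nil.
rewrite big_cons (_ : (fun _ => _) = fun k => F j k + \sum_(j <- q) F j k).
  exact: has_sumD.
by apply/funext => k; rewrite big_cons.
Qed.

Lemma has_sumMr f s c : 0 <= c -> has_sum f s ->
  has_sum (fun k => f k * c) (s * c).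
Proof.
move=> c0 [f0 fs]; split=> [k|]; first exact: mulr_ge0.
have [->|cn0] := eqVneq c 0.
  by rewrite mulr0 esum1// => k _; rewrite mulr0.
have cp : 0 < c by rewrite lt_neqAle eq_sym cn0.
have le_sc : (\esum_(k in [set: I]) (f k * c)%:E <= (s * c)%:E)%E.
  apply: ge_ereal_sup => _ [A [finA _] <-].
  rewrite fsbig_finite//= sumEFin lee_fin -mulr_suml ler_wpM2r//.
  by apply: has_sum_ge_seq => //; exact: finmap.fset_uniq.
have fin : (\esum_(k in [set: I]) (f k * c)%:E)%E \is a fin_num.
  rewrite ge0_fin_numE; first exact: le_lt_trans le_sc (ltry _).
  by apply: esum_ge0 => k _; rewrite lee_fin mulr_ge0.
apply/eqP; rewrite eq_le le_sc andbT -(fineK fin) lee_fin.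
have fcy : has_sum (fun k => f k * c) (fine (\esum_(k in [set: I]) (f k * c)%:E)).
  by split=> [k|]; [exact: mulr_ge0|rewrite fineK].
have := @has_sum_le _ _ _ _ c^-1 (conj f0 fs) fcy.
rewrite mulrC ler_pdivlMr// => -> // k.
by rewrite mulrC mulfK.
Qed.

Lemma has_sum_mem f r : uniq r -> (forall k, 0 <= f k) ->
  has_sum (fun k => if k \in r then f k else 0) (\sum_(k <- r) f k).
Proof.
move=> ur f0; split=> [k|]; first by case: ifP.
have -> : (fun k => (if k \in r then f k else 0)%:E) =
    (fun k => if k \in [set` r]%classic then (f k)%:E else 0%E).
  by apply/funext => k; rewrite mem_setE; case: ifP.
rewrite -esum_mkcond esum_fset//; last by move=> k _; rewrite lee_fin.
by rewrite -fsbig_seq// sumEFin.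
Qed.

End HasSum.

(** * Positive transitions and chains *)

Section Positivity.
Context (R : realType) (I : countType) (p : I -> I -> R -> R).
Hypothesis hp : positive_matrix_semigroup p.
Implicit Types (i j k l : I) (s t h T : R) (q : seq I).

Let p_ge0 i j t : 0 < t -> 0 <= p i j t.
Proof. exact: pms_ge0 hp i j t. Qed.

Lemma has_sum_semigroup i j t s : 0 < t -> 0 < s ->
  has_sum (fun k => p i k t * p k j s) (p i j (t + s)).
Proof.
move=> t0 s0; split; last exact: (pms_semigroup hp).
by move=> k; rewrite mulr_ge0 ?p_ge0.
Qed.

Lemma positive_comp k i j t s : 0 < t -> 0 < s ->
  0 < p i k t -> 0 < p k j s -> 0 < p i j (t + s).
Proof.
move=> t0 s0 ik kj.
have := has_sum_ge_seq (r := [:: k]) (has_sum_semigroup i j t0 s0) isT.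
by rewrite big_seq1; apply: lt_le_trans; exact: mulr_gt0.
Qed.

Lemma positive_split i j t s : 0 < t -> 0 < s -> 0 < p i j (t + s) ->
  exists2 k, 0 < p i k t & 0 < p k j s.
Proof.
move=> t0 s0 /(has_sum_gt_seq (has_sum_semigroup i j t0 s0))[r _ rpos].
apply: contrapT => none; move: rpos; rewrite big1 ?ltxx// => k _.
apply/eqP; rewrite mulf_eq0; apply/negP => /negP.
rewrite negb_or => /andP[ik kj].
by apply: none; exists k; rewrite lt_neqAle eq_sym p_ge0 ?andbT.
Qed.

Definition step h : rel I := fun k l => 0 < p k l h.

Lemma path_positive h i q : 0 < h -> path (step h) i q -> (0 < size q)%N ->
  0 < p i (last i q) ((size q)%:R * h).
Proof.
move=> h0; elim: q i => [//|x [|y q] IH] i /=.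
  by rewrite andbT mul1r.
move=> /andP[ix xq] _.
rewrite -natr1 mulrDl mul1r addrC; apply: (positive_comp (k := x)) => //.
  by rewrite mulr_gt0// ltr0n.
exact: IH.
Qed.

(** * The number of visits to a finite set *)

(** Divided by [p i j (n.+1%:R * h)], the double sum is the expected number of
    times among [h, 2h, ..., nh] at which the bridge from [i] to [j] is in [r].
    An expectation is at most any bound [d] valid on every chain of
    positive probability.  Stating this by induction on the chain, with the
    first step split off by the semigroup identity, avoids any measure on
    paths; [d] ranges over the reals because it decreases by one at each visit
    and may become negative for states from which no chain reaches [j]. *)
Lemma expected_visits_le h r j n i (d : R) : 0 < h -> uniq r ->
  (forall q, path (step h) i q -> size q = n.+1 -> last i q = j ->
     (count (mem r) q)%:R <= d) ->
  \sum_(m < n) \sum_(k <- r) p i k (m.+1%:R * h) * p k j ((n - m)%:R * h)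
    <= d * p i j (n.+1%:R * h).
Proof.
move=> h0 ur.
have Sh m : 0 < m.+1%:R * h by rewrite mulr_gt0// ltr0n.
elim: n i d => [|n IH] i d hq.
  rewrite big_ord0 mul1r.
  have [pij|] := ltP 0 (p i j h); last first.
    by move=> pij; rewrite (_ : p i j h = 0) ?mulr0//; apply/eqP; rewrite eq_le pij p_ge0.
  rewrite mulr_ge0 ?p_ge0//.
  apply: le_trans (hq [:: j] _ erefl erefl); first exact: ler0n.
  by rewrite /= /step pij.
rewrite big_ord_recl /= subn0 mul1r.
pose V l := \sum_(m < n) \sum_(k <- r)
  p l k (m.+1%:R * h) * p k j ((n - m)%:R * h).
(* The visit at time [h] and the visits after it. *)
have now := has_sum_mem ur (fun k => mulr_ge0 (p_ge0 i k h0) (p_ge0 k j (Sh n))).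
have later : has_sum (fun l => p i l h * V l)
    (\sum_(m < n) \sum_(k <- r)
       p i k (m.+2%:R * h) * p k j ((n - m)%:R * h)).
  have -> : (fun l => p i l h * V l) = (fun l => \sum_(m < n) \sum_(k <- r)
       p i l h * p l k (m.+1%:R * h) * p k j ((n - m)%:R * h)).
    apply/funext => l; rewrite /V mulr_sumr; apply: eq_bigr => m _.
    by rewrite mulr_sumr; apply: eq_bigr => k _; rewrite mulrA.
  apply: has_sum_sum => m; apply: has_sum_sum => k.
  apply: has_sumMr.
    by apply: p_ge0; rewrite mulr_gt0// ltr0n subn_gt0.
  rewrite (_ : m.+2%:R * h = h + m.+1%:R * h); first exact: has_sum_semigroup.
  by rewrite -[in LHS]natr1 mulrDl mul1r addrC.
have total := has_sum_semigroup i j h0 (Sh n).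
rewrite (_ : n.+2%:R * h = h + n.+1%:R * h); last first.
  by rewrite -[in LHS]natr1 mulrDl mul1r addrC.
apply: (has_sum_le (has_sumD now later) total) => l.
have [il|] := ltP 0 (p i l h); last first.
  move=> il; rewrite (_ : p i l h = 0); last first.
    by apply/eqP; rewrite eq_le il p_ge0.
  by rewrite !mul0r !mulr0 addr0; case: ifP.
have : V l <= (d - (l \in r)%:R) * p l j (n.+1%:R * h).
  apply: IH => q lq sq lastq; rewrite lerBrDl -natrD.
  by apply: (hq (l :: q)); rewrite /= ?sq// /step il.
rewrite -(ler_pM2l il) => /(lerD (lexx _)) /le_trans; apply.
by case: (l \in r); rewrite ?mulr0 ?mulr1n ?mulr0n; nra.
Qed.
Lemma semigroup_continuous_at i j t : 0 < t ->
  (p i j x @[x --> t] --> p i j t)%classic.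
Proof.
move=> t0; have := pms_continuous hp (i := i) (j := j).
rewrite continuous_open_subspace; last exact: interval_open.
by move/(_ t); apply; rewrite inE /= in_itv/= t0.
Qed.

(** Dini's argument.  For each [s] the terms sum to [p i j T], so finitely many
    states already exceed [c]; by continuity they do so near [s], and
    adding more states only helps.  Compactness of [[a, b]] makes the choice
    uniform; exhausting [I] by the initial segments of an enumeration gives
    the increasing family of finite sets that this needs. *)
Lemma uniform_capture i j T (a b c : R) : 0 < a -> b < T -> c < p i j T ->
  exists2 r, uniq r & forall s, a <= s <= b ->
    c < \sum_(k <- r) p i k s * p k j (T - s).
Proof.
move=> a0 bT cP.
(* The states whose code in the enumeration of [I] is less than [N]. *)
pose r N := pmap (@pickle_inv I) (iota 0 N).
have ur N : uniq (r N) by apply: (pmap_uniq pickle_invK); exact: iota_uniq.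
have mem_r N k : (k \in r N) = (pickle k < N)%N.
  by rewrite (can2_mem_pmap pickle_invK pickleK_inv) mem_iota.
have hs s : a <= s <= b ->
    has_sum (fun k => p i k s * p k j (T - s)) (p i j T).
  move=> sab; rewrite -{2}(subrKC s T).
  by apply: has_sum_semigroup; lra.
pose P N s := a <= s <= b -> c < \sum_(k <- r N) p i k s * p k j (T - s).
have local s : `[a, b]%classic s ->
    (\forall x \near s & N \near \oo, P N x)%classic.
  rewrite /= in_itv/= => sab.
  have [q uq cq] := has_sum_gt_seq (hs s sab) cP.
  have cont : ((\sum_(k <- q) p i k x * p k j (T - x)) @[x --> s] -->
               \sum_(k <- q) p i k s * p k j (T - s))%classic.
    apply: cvg_big; first exact: add_continuous.
    move=> k _; apply: cvgM; first by apply: semigroup_continuous_at; lra.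
    apply: (@cvg_comp _ _ _ (fun x => T - x) (p k j) _ (nbhs (T - s))).
      by apply: cvgB; [exact: cvg_cst|exact: cvg_id].
    by apply: semigroup_continuous_at; lra.
  have [N qN] : exists N, {subset q <= r N}.
    exists (\max_(k <- q) (pickle k).+1)%N => k kq.
    by rewrite mem_r (leq_bigmax_seq (F := fun k => (pickle k).+1)).
  near=> x M => xab /=.
  have cqx : c < \sum_(k <- q) p i k x * p k j (T - x).
    by near: x; exact: cvgr_gt cont _ cq.
  apply: (lt_le_trans cqx).
  have qM : {subset q <= r M}.
    move=> k /qN; rewrite !mem_r => /leq_trans; apply.
    by near: M; exact: nbhs_infty_ge.
  have := has_sum_ge_seq (has_sum_mem (ur M) (hs x xab).1) uq.
  by rewrite (eq_big_seq _ (fun k kq => ifT _ _ (qM k kq))).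
have [N _ /(_ N (leqnn _)) NP] :=
  (compact_near_coveringP _).1 (@segment_compact R a b) _ _ _ _ local.
by exists (r N) => // s sab; apply: NP; rewrite //= in_itv.
Unshelve. all: by end_near. Qed.

(** With [N = M * K] steps, the [(M - 2) * K] middle grid times lie in
    [[T / M, T - T / M]], where [r] has bridge probability more than
    [1 - 1 / M].  The expected number of visits therefore exceeds [(M - 4) * K],
    and some chain realises this.  The point is that [r] depends on [M] only,
    while [K] is free. *)
Lemma path_mostly_in_finite i j T M : 0 < T -> 0 < p i j T -> (4 <= M)%N ->
  exists r : seq I, forall K, (0 < K)%N ->
    exists q, [/\ path (step (T / (M * K)%:R)) i q, size q = (M * K)%N,
      last i q = j & (M * K <= count (mem r) q + 4 * K)%N].
Proof.
move=> T0 P0 M4.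
have M0 : 0 < M%:R :> R by rewrite ltr0n; lia.
have [|||r ur rP] := @uniform_capture i j T (T / M%:R) (T - T / M%:R)
   ((1 - M%:R^-1) * p i j T).
- by rewrite divr_gt0.
- by rewrite ltrBlDr ltrDl divr_gt0.
- by rewrite gtr_pMl// ltrBlDr ltrDl invr_gt0.
exists r => K K0; set h := T / _; apply: contrapT => none.
have K0' : 0 < K%:R :> R by rewrite ltr0n.
have h0 : 0 < h by rewrite divr_gt0// ltr0n; lia.
have Eh : (M * K)%:R * h = T by rewrite mulrC divfK// pnatr_eq0; lia.
have EKh : K%:R * h = T / M%:R.
  by rewrite /h natrM; field; rewrite !gt_eqF.
have MK : (M * K = (M * K).-1.+1)%N by lia.
have := @expected_visits_le h r j (M * K).-1 i (M%:R * K%:R - 4 * K%:R) h0 ur.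
rewrite -MK Eh => /(_ _)/wrap[].
  move=> q iq sq lq; rewrite lerBrDr -!natrM -natrD ler_nat leqNgt.
  by apply/negP => big; apply: none; exists q; split => //; apply: ltnW.
apply/negP; rewrite -ltNge.
pose F m := \sum_(k <- r) p i k (m.+1%:R * h) * p k j (((M * K).-1 - m)%:R * h).
have F0 m : (m < (M * K).-1)%N -> 0 <= F m.
  move=> mMK; apply: sumr_ge0 => k _.
  by rewrite mulr_ge0// p_ge0// mulr_gt0// ltr0n// subn_gt0.
rewrite -(big_mkord xpredT F).
rewrite (@big_cat_nat _ _ _ K)//=; last by nia.
rewrite (@big_cat_nat _ _ _ (M.-1 * K)%N _ (M * K).-1)//=; [|nia|nia].
have S1 : 0 <= \sum_(0 <= m < K) F m.
  by rewrite big_nat; apply: sumr_ge0 => m mK; apply: F0; nia.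
have S3 : 0 <= \sum_(M.-1 * K <= m < (M * K).-1) F m.
  by rewrite big_nat; apply: sumr_ge0 => m mK; apply: F0; nia.
have S2 : ((M%:R - 2) * K%:R) * ((1 - M%:R^-1) * p i j T) <=
    \sum_(K <= m < M.-1 * K) F m.
  have -> : (M%:R - 2) * K%:R = (M.-1 * K - K)%:R :> R.
    rewrite natrB; last by nia.
    by rewrite natrM -subn1 natrB; [ring|lia].
  rewrite mulr_natl -sumr_const_nat; apply: ler_sum_nat => m mK.
  rewrite /F (_ : ((M * K).-1 - m)%:R * h = T - m.+1%:R * h); last first.
    rewrite (_ : ((M * K).-1 - m)%N = (M * K - m.+1)%N); last by lia.
    by rewrite natrB; [rewrite mulrBl Eh|nia].
  apply/ltW/rP; rewrite -EKh ler_pM2r// ler_nat; apply/andP; split; first by lia.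
  rewrite -Eh -mulrBl ler_pM2r// -natrB; last by nia.
  by rewrite ler_nat; nia.
suff : (M%:R * K%:R - 4 * K%:R) * p i j T <
    ((M%:R - 2) * K%:R) * ((1 - M%:R^-1) * p i j T) by lra.
rewrite mulrA ltr_pM2r//.
have -> : (M%:R - 2) * K%:R * (1 - M%:R^-1) = (M%:R - 3 + 2 * M%:R^-1) * K%:R :> R.
  by field; rewrite gt_eqF.
rewrite -mulrBl ltr_pM2r//.
have : 0 < M%:R^-1 :> R by rewrite invr_gt0.
lra.
Qed.

(** * Loops and loop erasure *)

Definition leads_to i j := exists2 t, 0 < t & 0 < p i j t.

Lemma leads_to_trans j i k : leads_to i j -> leads_to j k -> leads_to i k.
Proof.
move=> [t t0 ij] [s s0 jk]; exists (t + s); first exact: addr_gt0.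
exact: positive_comp ij jk.
Qed.

Lemma path_leads_to h i q : 0 < h -> path (step h) i q ->
  (0 < size q)%N -> leads_to i (last i q).
Proof.
move=> h0 iq q0; exists ((size q)%:R * h); first by rewrite mulr_gt0// ltr0n.
exact: path_positive.
Qed.

(** A chain without repetition visits the finite set [r] at most [size r] times.
    With [K = size r + 1], loop erasure thus leaves at most [5 * K] of the
    [M * K] steps of the chain above, that is a duration of at most
    [5 * T / M]. *)
Lemma positive_small_times i j e : leads_to i j -> 0 < e ->
  exists t, 0 < t < e /\ 0 < p i j t.
Proof.
move=> [T T0 ij] e0.
(* Large enough for [5 * T / M < e]; the summand 4 ensures the hypothesis of
   [path_mostly_in_finite]. *)
pose M := ((Num.bound (5 * T / e)).+1 + 4)%N.
have M0 : 0 < M%:R :> R by rewrite ltr0n.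
have Me : 5 * T / e < M%:R.
  apply: (lt_le_trans (archi_boundP _)); first by rewrite divr_ge0//; lra.
  by rewrite ler_nat /M; lia.
have [|r rP] := path_mostly_in_finite (M := M) T0 ij; first by rewrite /M; lia.
have [[|x q] [iq sq lq cq]] := rP (size r).+1 isT.
  by move: sq; rewrite /M /=; lia.
set h := T / _ in iq.
have h0 : 0 < h by rewrite divr_gt0// ltr0n; rewrite /M; lia.
move: iq lq => /= /andP[ix xq].
(* Loops are erased from [x] on, not from [i]: if [i = j], erasing from [i]
   would leave the empty chain, of duration 0. *)
case: (shortenP xq) => q' xq' uq' sub lq.
have xq'pos : path (step h) i (x :: q') by rewrite /= ix.
exists ((size (x :: q'))%:R * h); split; last first.
  by rewrite -lq; apply: (path_positive h0 xq'pos).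
apply/andP; split; first by rewrite mulr_gt0// ltr0n.
have inF : (count (mem r) (x :: q') <= size r)%N.
  rewrite -size_filter uniq_leq_size ?filter_uniq// => y.
  by rewrite mem_filter => /andP[].
have outF : (count (predC (mem r)) (x :: q') <= count (predC (mem r)) (x :: q))%N.
  rewrite -!size_filter uniq_leq_size ?filter_uniq// => y.
  rewrite !mem_filter => /andP[-> /=]; rewrite !inE => /orP[->//|/sub ->].
  by rewrite orbT.
have cqC := count_predC (mem r) (x :: q).
have cq'C := count_predC (mem r) (x :: q').
have small : (size (x :: q') <= 5 * (size r).+1)%N.
  rewrite -cq'C mulSn leq_add// ?(leq_trans inF)//.
  by rewrite (leq_trans outF)// -(leq_add2l (count (mem r) (x :: q))) cqC sq.
have K0 : 0 < (size r).+1%:R :> R by rewrite ltr0n.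
apply: (@le_lt_trans _ _ ((5 * (size r).+1)%:R * h)).
  by rewrite ler_pM2r// ler_nat.
have -> : (5 * (size r).+1)%:R * h = 5 * T / M%:R.
  by rewrite /h !natrM; field; rewrite !gt_eqF.
by move: Me; rewrite !ltr_pdivrMr// [M%:R * e]mulrC.
Qed.

Lemma path_repeat h i q : 0 < h -> path (step h) i q -> ~~ uniq q ->
  exists k, [/\ leads_to i k, leads_to k k & leads_to k (last i q)].
Proof.
move=> h0; elim: q i => // x q IH i /= /andP[ix xq].
have i_x : leads_to i x by exists h.
have [xinq _|_ /= nuq] := boolP (x \in q).
  case/splitPr: xinq xq => q1 q2; rewrite -cat_rcons cat_path last_rcons.
  move=> /andP[xx xq2].
  have x_x : leads_to x x.
    by have := path_leads_to h0 xx; rewrite last_rcons size_rcons; apply.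
  exists x; split=> //; rewrite last_cat last_rcons.
  case: q2 xq2 => [//|y q2] xq2; exact: (path_leads_to h0 xq2).
have [k [xk kk kl]] := IH x xq nuq.
by exists k; split=> //; exact: leads_to_trans xk.
Qed.

(** A chain with [5 * K] vertices of which at most [4 * K] are outside [r]
    cannot be free of repetitions once [K > size r]. *)
Lemma leads_through_recurrent i j : leads_to i j ->
  exists k, [/\ leads_to i k, leads_to k k & leads_to k j].
Proof.
move=> [T T0 ij].
have [|r rP] := path_mostly_in_finite (M := 5) T0 ij; first by [].
have [q [iq sq lq cq]] := rP (size r).+1 isT.
rewrite -lq; apply: (path_repeat _ iq).
  by rewrite divr_gt0// ltr0n; lia.
apply/negP => uq.
have : (count (mem r) q <= size r)%N.
  rewrite -size_filter uniq_leq_size ?filter_uniq// => y.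
  by rewrite mem_filter => /andP[].
lia.
Qed.

(** * Density of the times of positivity *)

(** All three durations [a], [b], [h] of [i -> k], [k -> j], [k -> k] can be
    taken short, and the times [a + m h + b] then form a fine grid. *)
Lemma positive_dense i j t e : leads_to i j -> 0 < e <= t ->
  exists2 s, 0 < p i j s & t - e < s <= t.
Proof.
move=> /leads_through_recurrent[k [ik kk kj]] /andP[e0 et].
have e3 : 0 < e / 3 by rewrite divr_gt0.
have [a [a_e ika]] := positive_small_times ik e3.
have [b [b_e kjb]] := positive_small_times kj e3.
have [h [h_e kkh]] := positive_small_times kk e3.
have h0 : 0 < h by lra.
have kj_loops m : 0 < p k j (m%:R * h + b).
  elim: m => [|m IH]; first by rewrite mul0r add0r.
  rewrite -natr1 mulrDl mul1r (addrC _ h) -addrA.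
  apply: (positive_comp _ _ kkh IH) => //.
  by rewrite ltr_wpDl ?mulr_ge0//; lra.
pose m := Num.truncn ((t - a - b) / h).
have tab : 0 <= (t - a - b) / h by rewrite divr_ge0//; lra.
have /andP[m1 m2] := truncn_itv tab; rewrite -/m in m1 m2.
exists (a + (m%:R * h + b)).
  apply: (positive_comp _ _ ika (kj_loops m)); first by lra.
  by rewrite ltr_wpDl ?mulr_ge0//; lra.
move: m1 m2; rewrite ler_pdivlMr// ltr_pdivrMr// -natr1 mulrDl mul1r => m1 m2.
lra.
Qed.

(** The times [u] with [p i k u > 0] form an open dense set, and so do those with
    [p k j (t - u) > 0]: they have a common point in [(0, t)]. *)
Lemma leads_to_positive i j t : leads_to i j -> 0 < t -> 0 < p i j t.
Proof.
move=> [T T0 ij] t0.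
have T20 : 0 < T / 2 by rewrite divr_gt0.
have [|k ikT kjT] := positive_split (t := T / 2) (s := T / 2) (i := i) (j := j) T20 T20.
  by rewrite -splitr.
have ik : leads_to i k by exists (T / 2).
have kj : leads_to k j by exists (T / 2).
have [|u iku ut] := @positive_dense i k (t / 2) (t / 4) ik; first by lra.
have u0 : 0 < u by lra.
have [e /= e0 ball_pos] := (nbhs_ballP _ _).1
  (cvgr_gt _ (@semigroup_continuous_at i k u u0) _ iku).
pose d := Num.min e (t / 4).
have d0 : 0 < d by rewrite lt_min e0 divr_gt0.
have [de dt] : d <= e /\ d <= t / 4 by rewrite !ge_min !lexx orbT.
have [|s kjs st] := @positive_dense k j (t - u) d kj; first by lra.
rewrite -(subrK s t); apply: (positive_comp _ _ _ kjs); [lra|lra|].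
by apply: ball_pos; rewrite /ball/= ltr_norml; apply/andP; split; lra.
Qed.

End Positivity.

Theorem theorem1p1 (R : realType) (I : countType) (p : I -> I -> R -> R)
    (hp : positive_matrix_semigroup p) (i j : I) :
  (forall t : R, 0 < t -> p i j t = 0) \/ (forall t : R, 0 < t -> 0 < p i j t).
Proof.
have [ij|none] := pselect (leads_to p i j).
  by right=> t t0; exact: leads_to_positive.
left=> t t0; apply/eqP; rewrite eq_le (pms_ge0 hp)// andbT leNgt.
by apply/negP => ijt; apply: none; exists t.
Qed.
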